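(* Let $W=TT^*$ on $\mathbb{R}$ with $T'=GT$, $G$ a matrix polynomial, as in the context. Then for every $n\ge0$ the monic orthogonal matrix polynomials satisfy the lowering relation $$\widehat P_n'(z)+\widehat P_n(z)G(z)=-\mathcal{B}_n(z;G)\widehat P_n(z)+\mathcal{A}_n^*(z;G)\beta_n\widehat P_{n-1}(z)$$ and the raising relation $$\widehat P_n'(z)+\widehat P_n(z)G(z)=\big(\mathcal{A}_n^*(z;G)(zI_N-\alpha_n)-\mathcal{B}_n(z;G)\big)\widehat P_n(z)-\mathcal{A}_n^*(z;G)\widehat P_{n+1}(z).$$
   Context: Fix $N\ge1$. The weight $W:\mathbb{R}\to GL(N,\mathbb{R})$ is smooth, $W(x)$ is (symmetric) positive definite for every $x\in\mathbb{R}$, and all entries of $W$ and $W'$ have finite moments of all orders on $\mathbb{R}$. $A^*$ is the conjugate transpose; for matrix functions of a complex variable $F^*(z):=(F(\bar z))^*$. It is assumed that $W(x)=T(x)T^*(x)$ for $x\in\mathbb{R}$, where $T$ is a smooth $N\times N$ matrix-valued function satisfying $T'=GT$ with a matrix polynomial $G$; hence $T$ extends to an entire, everywhere invertible matrix function satisfying $T'(z)=G(z)T(z)$ on $\mathbb{C}$. $\widehat P_n(x)=x^nI_N+\sum_{j=0}^{n-1}a_{n,j}x^j$ is the monic matrix polynomial of degree $n$ with $\int_{\mathbb{R}}\widehat P_n W Q^*dx=0$ for all matrix polynomials $Q$ of degree $\le n-1$; $a_{n,n}=I_N$ and $a_{n,j}=0$ for $j<0$ or $j>n$. $\gamma_n=\big(\int_{\mathbb{R}}\widehat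 P_nW\widehat P_n^*dx\big)^{-1}$. $b_{n,k}=\int_{\mathbb{R}}x^k\widehat P_n(x)W(x)dx$ for $k\ge n$, and $b_{n,k}=0$ for $k<n$. $\alpha_n=a_{n,n-1}-a_{n+1,n}$, $\beta_n=\gamma_n^{-1}\gamma_{n-1}$ ($n\ge1$) are the coefficients of the recurrence $x\widehat P_n=\widehat P_{n+1}+\alpha_n\widehat P_n+\beta_n\widehat P_{n-1}$; $\beta_0=0$, $\widehat P_{-1}=0$. For any matrix polynomial $K(z)=\sum_{j=0}^mM_jz^j$ define $\widehat P_{n,k}(z)=z^kI_N+a_{n,n-1}z^{k-1}+\cdots+a_{n,n-k}$, $\Delta_{j,n}(z)=\sum_{k=0}^j\widehat P_{n,k}(z)M_{m-j+k}$, $$\mathcal{A}_n(z;K)=-\gamma_n\sum_{j=0}^{m-1}\big(b_{n,n+m-j-1}\Delta_{j,n}^*(z)+\Delta_{j,n}(z)b_{n,n+m-j-1}^*\big),$$ $$\mathcal{B}_n(z;K)=-\sum_{j=0}^{m}\big(\Delta_{j,n}(z)b_{n-1,n+m-j-1}^*+b_{n,n+m-j-2}\Delta_{j,n-1}^*(z)\big)\gamma_{n-1}\quad(n\ge1),$$ with the convention $\mathcal{B}_0(z;K):=-K(z)$. *)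

(* Defs.v *)
From HB Require Import structures.
From mathcomp Require Import all_boot all_order all_algebra.
From mathcomp Require Import all_classical all_reals all_analysis.
From mathcomp.real_closed Require Import complex.

Set Implicit Arguments.
Unset Strict Implicit.
Unset Printing Implicit Defensive.

Import Order.TTheory GRing.Theory Num.Theory.
Import numFieldNormedType.Exports.

Local Open Scope classical_set_scope.
Local Open Scope ring_scope.
Local Open Scope sesquilinear_scope.

(* Matrices have size N.+1, so that square
   matrices form a nontrivial ring and matrix polynomials are polynomials over
   that ring, with coefficients in the field R[i] of complex numbers. *)

Section Calculus.
Context {R : realType} {N : nat}.
Implicit Types (T F : R -> 'M[R[i]]_N.+1) (p : {poly 'M[R[i]]_N.+1}).

Definition smooth (V : normedModType R) (f : R -> V) :=
  forall k x, derivable (derive1n k f) x 1.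

Definition Remx F : R -> 'M[R]_N.+1 := fun x => map_mx (@complex.Re R) (F x).
Definition Immx F : R -> 'M[R]_N.+1 := fun x => map_mx (@complex.Im R) (F x).

Definition csmooth F := smooth (Remx F) /\ smooth (Immx F).

Definition cderive1 F : R -> 'M[R[i]]_N.+1 := fun x =>
  \matrix_(i, j) (derive1 (Remx F) x i j +i* derive1 (Immx F) x i j)%C.

Definition mxintegral F : 'M[R[i]]_N.+1 :=
  \matrix_(i, j) ((\int[@lebesgue_measure R]_x Remx F x i j) +i*
                  (\int[@lebesgue_measure R]_x Immx F x i j))%C.

(* Scalar matrices commute with everything, so this is \sum_j p`_j z^j. *)
Definition mxeval p (z : R[i]) : 'M[R[i]]_N.+1 := p.[z%:M].

Definition star (F : R[i] -> 'M[R[i]]_N.+1) : R[i] -> 'M[R[i]]_N.+1 :=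
  fun z => (F (z^*)) ^t*.

End Calculus.

Section Weight.
Context {R : realType} {N : nat}.
Implicit Types (W : R -> 'M[R]_N.+1).

Definition posdefmx (A : 'M[R]_N.+1) :=
  A^T = A /\ forall v : 'cV[R]_N.+1, v != 0 -> 0 < (v^T *m A *m v) 0 0.

Definition finite_moments W := forall (k : nat) i j,
  (@lebesgue_measure R).-integrable setT (fun x : R => (x ^+ k * W x i j)%:E).

Definition is_weight W :=
  [/\ smooth W,
      forall x, W x \in unitmx,
      forall x, posdefmx (W x),
      finite_moments W
    & finite_moments (derive1 W)].

Definition cmx (A : 'M[R]_N.+1) : 'M[R[i]]_N.+1 := map_mx (real_complex R) A.

(* The matrix inner product \int P W Q^*. *)
Definition wprod W (p q : {poly 'M[R[i]]_N.+1}) : 'M[R[i]]_N.+1 :=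
  mxintegral (fun x =>
    mxeval p (x%:C)%C *m cmx (W x) *m (mxeval q (x%:C)%C) ^t*).

Definition monic_orthogonal W (P : nat -> {poly 'M[R[i]]_N.+1}) :=
  forall n, [/\ P n \is monic, size (P n) = n.+1
    & forall Q : {poly 'M[R[i]]_N.+1}, (size Q <= n)%N -> wprod W (P n) Q = 0].

End Weight.

Section Coefficients.
Context {R : realType} {N : nat}.
Variables (W : R -> 'M[R]_N.+1) (P : nat -> {poly 'M[R[i]]_N.+1}).
Implicit Types (n : nat) (z : R[i]) (K : {poly 'M[R[i]]_N.+1}).

(* The second index ranges over int because indices such as n - k may be
   negative, where truncated subtraction would give a wrong coefficient. *)
Definition coef_a n (k : int) : 'M[R[i]]_N.+1 :=
  if k is Posz j then (P n)`_j else 0.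

Definition coef_b n (k : int) : 'M[R[i]]_N.+1 :=
  if k is Posz j then
    if (n <= j)%N then
      mxintegral (fun x =>
        (x%:C)%C ^+ j *: (mxeval (P n) (x%:C)%C *m cmx (W x)))
    else 0
  else 0.

Definition gamma n := invmx (wprod W (P n) (P n)).

Definition alpha n := coef_a n (n%:Z - 1) - coef_a n.+1 n%:Z.

Definition beta n :=
  if n is n'.+1 then invmx (gamma n) *m gamma n' else 0.

(* P_{n-1}, with P_{-1} = 0. *)
Definition Pprev n := if n is n'.+1 then P n' else 0.

(* The i = 0 term is z^k I because coef_a n n = I. *)
Definition Ptrunc n k z : 'M[R[i]]_N.+1 :=
  \sum_(i < k.+1) z ^+ (k - i) *: coef_a n (n%:Z - i%:Z).

Definition mdeg K := (size K).-1.

Definition Delta K j n z : 'M[R[i]]_N.+1 :=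
  \sum_(k < j.+1) Ptrunc n k z *m K`_(mdeg K - j + k).

Definition calA n K z : 'M[R[i]]_N.+1 :=
  let m := mdeg K in
  - (gamma n *m \sum_(j < m)
      (coef_b n ((n + m)%:Z - j%:Z - 1) *m star (Delta K j n) z
       + Delta K j n z *m (coef_b n ((n + m)%:Z - j%:Z - 1)) ^t*)).

Definition calB n K z : 'M[R[i]]_N.+1 :=
  let m := mdeg K in
  if n is n'.+1 then
    - ((\sum_(j < m.+1)
      (Delta K j n z *m (coef_b n' ((n + m)%:Z - j%:Z - 1)) ^t*
       + coef_b n ((n + m)%:Z - j%:Z - 2) *m star (Delta K j n') z))
       *m gamma n')
  else - mxeval K z.

End Coefficients.

(* Main.v *)
Require Import Defs.
From HB Require Import structures.
From mathcomp Require Import all_boot all_order all_algebra.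
From mathcomp Require Import all_classical all_reals all_analysis.
From mathcomp Require Import measurable_realfun ring zify.
From mathcomp.real_closed Require Import complex.

(* Write <p, q> for the integral of p W q^*, F_n = P_n G, and d_w F for the
   divided difference (F(X) - F(w)) / (X - w).  The sums defining A_n^* and B_n
   are the expansions of <d_z F_n, P_n>, <P_n, d_zbar F_n>, <d_z F_n, P_{n-1}>
   and <P_n, d_zbar F_{n-1}> in the coefficients of the divided differences.
   Since W' = G W + W G^*, integration by parts makes p |-> p' + p G
   skew-adjoint.  By Christoffel-Darboux, (X - zbar) k_z is a combination of
   P_n and P_{n-1}, where k_z is the reproducing kernel of degree < n.  Hence
   the right-hand side of the lowering relation is
     - <d_z F_n, (X - zbar) k_z> - <P_n, k_z G>
       = F_n(z) - <F_n, k_z> - <P_n, k_z G>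
       = F_n(z) + <P_n', k_z> + <P_n, k_z'> = F_n(z) + P_n'(z).
   The raising relation follows from the three-term recurrence.  Everything but
   integration by parts and positivity is algebra on the moments of W. *)

Set Implicit Arguments.
Unset Strict Implicit.
Unset Printing Implicit Defensive.

Import Order.TTheory GRing.Theory Num.Theory.
Import numFieldNormedType.Exports.

Local Open Scope ring_scope.
Local Open Scope sesquilinear_scope.

(** * Moment forms on matrix polynomials *)

Section Adjoint.
Context {C : numClosedFieldType} {N : nat}.
Implicit Types A B : 'M[C]_N.+1.

Lemma ctrmxD A B : (A + B)^t* = A^t* + B^t*.
Proof. by rewrite linearD map_mxD. Qed.

Lemma ctrmxB A B : (A - B)^t* = A^t* - B^t*.
Proof. by rewrite linearB map_mxB. Qed.

Lemma ctrmxN A : (- A)^t* = - A^t*.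
Proof. by rewrite linearN map_mxN. Qed.

Lemma ctrmxM A B : (A * B)^t* = B^t* * A^t*.
Proof. by rewrite trmx_mul map_mxM. Qed.

Lemma ctrmx_scalar (z : C) : (z%:M : 'M[C]_N.+1)^t* = (z^*)%:M.
Proof. by rewrite tr_scalar_mx map_scalar_mx. Qed.

Lemma ctrmx1 : (1 : 'M[C]_N.+1)^t* = 1.
Proof. by rewrite ctrmx_scalar conjC1. Qed.

Lemma ctrmx0 : (0 : 'M[C]_N.+1)^t* = 0.
Proof. by rewrite linear0 map_mx0. Qed.

Lemma ctrmx_sum I (r : seq I) (Q : pred I) (F : I -> 'M[C]_N.+1) :
  (\sum_(i <- r | Q i) F i)^t* = \sum_(i <- r | Q i) (F i)^t*.
Proof. by rewrite linear_sum raddf_sum. Qed.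

End Adjoint.

(** * Divided differences over a noncommutative ring *)

Section DividedDifference.
Context {S : nzRingType}.
Implicit Types (p q F : {poly S}) (w : S).

(* The quotient (F(X) - F(w)) / (X - w). *)
Definition divdiff w F := \poly_(s < size F) (drop_poly s.+1 F).[w].

Lemma drop_poly_rec F s :
  drop_poly s F = drop_poly s.+1 F * 'X + (F`_s)%:P.
Proof.
apply/polyP => -[|i]; rewrite coefD coefMX coefC !coef_drop_poly /= ?add0n ?add0r//.
by rewrite addr0 addnS addSn.
Qed.

Lemma horner_drop_poly_oversize w F s :
  (size F <= s)%N -> (drop_poly s F).[w] = 0.
Proof. by move=> h; rewrite drop_poly_eq0// horner0. Qed.

Lemma coef_divdiff w F s : (divdiff w F)`_s = (drop_poly s.+1 F).[w].
Proof.
rewrite coef_poly; case: ltnP => // h.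
by rewrite horner_drop_poly_oversize// ltnW.
Qed.

(** Synthetic division on the right: [drop_poly_rec] is Horner's recursion for the coefficients of
    the quotient. Evaluation puts [w] to the right of the coefficients, so nothing has to
    commute. *)
Lemma divdiffP w F : divdiff w F * ('X - w%:P) = F - (F.[w])%:P.
Proof.
apply/polyP => s; rewrite mulrBr !coefB coefMX coefMC coefC !coef_divdiff.
case: s => [|s] /=.
  rewrite sub0r -[in F.[w]](drop_poly0l F) (drop_poly_rec F 0) hornerMXaddC.
  by rewrite opprD addrCA subrr addr0.
rewrite [in LHS](drop_poly_rec F s.+1) hornerMXaddC.
by rewrite subr0 addrC addKr.
Qed.

Lemma divdiffB w p q : divdiff w (p - q) = divdiff w p - divdiff w q.
Proof.
by apply/polyP => s; rewrite coefB !coef_divdiff linearB hornerD hornerN.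
Qed.

Lemma divdiffZ w c p : divdiff w (c *: p) = c *: divdiff w p.
Proof. by apply/polyP => s; rewrite coefZ !coef_divdiff linearZ hornerZ. Qed.

Lemma divdiff_uniq w F Q c : Q * ('X - w%:P) = F - c%:P -> c = F.[w] -> Q = divdiff w F.
Proof.
move=> h ec; apply: (monic_rreg (monicXsubC w)).
by rewrite h divdiffP ec.
Qed.

End DividedDifference.

Section MomentForm.
Context {C : numClosedFieldType} {N : nat}.
Variable mu : nat -> 'M[C]_N.+1.
Implicit Types p q : {poly 'M[C]_N.+1}.

(** For mu_k the integral of x^k W this is <p, q>, the integral of p W q^*. The dependence on i + j
    alone (block Hankel structure) makes multiplication by X symmetric. *)
Definition mform p q :=
  \sum_(i < size p) \sum_(j < size q) p`_i * mu (i + j) * (q`_j)^t*.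

Lemma mform_wide p q a b : (size p <= a)%N -> (size q <= b)%N ->
  mform p q = \sum_(i < a) \sum_(j < b) p`_i * mu (i + j) * (q`_j)^t*.
Proof.
move=> hp hq; rewrite /mform.
rewrite (big_ord_widen _ (fun i => \sum_(j < size q) p`_i * mu (i + j) * (q`_j)^t*) hp).
rewrite big_mkcond; apply: eq_bigr => i _; case: ltnP => hi; last first.
  by rewrite big1 // => j _; rewrite nth_default// !mul0r.
rewrite (big_ord_widen _ (fun j => p`_i * mu (i + j) * (q`_j)^t*) hq).
rewrite big_mkcond; apply: eq_bigr => j _; case: ltnP => // hj.
by rewrite [q`_j]nth_default// ctrmx0 mulr0.
Qed.

Lemma mformDl p1 p2 q : mform (p1 + p2) q = mform p1 q + mform p2 q.
Proof.
set a := maxn (size p1) (size p2).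
rewrite !(@mform_wide _ q a (size q)) ?size_polyD ?leq_maxl ?leq_maxr//.
rewrite -big_split /=; apply: eq_bigr => i _.
by rewrite -big_split; apply: eq_bigr => j _; rewrite /= coefD !mulrDl.
Qed.

Lemma mformZl c p q : mform (c *: p) q = c * mform p q.
Proof.
rewrite (@mform_wide (c *: p) q (size p) (size q)) ?size_scale_leq//.
rewrite mulr_sumr; apply: eq_bigr => i _.
by rewrite mulr_sumr; apply: eq_bigr => j _; rewrite coefZ !mulrA.
Qed.

Lemma mform0l q : mform 0 q = 0.
Proof. by rewrite /mform size_poly0 big_ord0. Qed.

Lemma mformNl p q : mform (- p) q = - mform p q.
Proof. by apply/eqP; rewrite -addr_eq0 -mformDl addNr mform0l. Qed.

Lemma mformBl p1 p2 q : mform (p1 - p2) q = mform p1 q - mform p2 q.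
Proof. by rewrite mformDl mformNl. Qed.

Lemma mform_Xn_r p k : mform p 'X^k = \sum_(i < size p) p`_i * mu (i + k).
Proof.
rewrite /mform size_polyXn; apply: eq_bigr => i _.
rewrite (bigD1 ord_max) //= coefXn eqxx ctrmx1 mulr1 big1 ?addr0// => j jk.
by rewrite coefXn (negPf (_ : j != k :> nat)) ?ctrmx0 ?mulr0.
Qed.

Lemma mformXl p q : mform (p * 'X) q = mform p (q * 'X).
Proof.
rewrite (@mform_wide _ q (size p).+1 (size q)) ?leqnn ?(leq_trans (size_polyMleq _ _))//;
  last by rewrite size_polyX addn2.
rewrite (@mform_wide p _ (size p) (size q).+1) ?leqnn ?(leq_trans (size_polyMleq _ _))//;
  last by rewrite size_polyX addn2.
rewrite big_ord_recl big1 ?add0r; last by move=> j _; rewrite coefMX !mul0r.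
apply: eq_bigr => i _; rewrite big_ord_recl [(q * 'X)`_ord0]coefMX ctrmx0 mulr0 add0r.
by apply: eq_bigr => j _; rewrite !coefMX /= /bump /= !add1n addSn addnS.
Qed.

Hypothesis mu_adj : forall k, (mu k)^t* = mu k.

Lemma mform_adj p q : (mform p q)^t* = mform q p.
Proof.
rewrite /mform ctrmx_sum exchange_big /=.
rewrite (eq_bigr (fun i : 'I_(size p) => \sum_(j < size q)
  q`_j * mu (j + i) * (p`_i)^t*)) //; last first.
  move=> i _; rewrite ctrmx_sum; apply: eq_bigr => j _.
  by rewrite !ctrmxM mu_adj trmxCK mulrA addnC.
Qed.

Lemma mformDr p q1 q2 : mform p (q1 + q2) = mform p q1 + mform p q2.
Proof. by rewrite -mform_adj mformDl ctrmxD !mform_adj. Qed.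

Lemma mformBr p q1 q2 : mform p (q1 - q2) = mform p q1 - mform p q2.
Proof. by rewrite -mform_adj mformBl ctrmxB !mform_adj. Qed.

Lemma mformZr c p q : mform p (c *: q) = mform p q * c^t*.
Proof. by rewrite -mform_adj mformZl ctrmxM mform_adj. Qed.

Lemma mformXnl k p q : mform (p * 'X^k) q = mform p (q * 'X^k).
Proof.
elim: k p q => [|k IH] p q; first by rewrite expr0 !mulr1.
by rewrite exprS !mulrA IH mformXl -!mulrA commr_polyXn.
Qed.

Lemma mformMnl p q n : mform (p *+ n) q = mform p q *+ n.
Proof.
by elim: n => [|n IH]; rewrite ?mulr0n ?mform0l // !mulrS mformDl IH.
Qed.

Lemma mform_Xn_1 k : mform 'X^k 1 = mu k.
Proof.
rewrite -(mul1r 'X^k) mformXnl mul1r mform_Xn_r size_poly1 big_ord1.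
by rewrite coef1 mul1r.
Qed.

Variable G : {poly 'M[C]_N.+1}.

(* Integration by parts of x^k W when W' = G W + W G^*. *)
Hypothesis moment_ibp : forall k, mu k.-1 *+ k +
  \sum_(r < size G) (G`_r * mu (r + k) + mu (r + k) * (G`_r)^t*) = 0.

(** The defect [sk] is additive, constants come out on either side, and X moves from one argument to
    the other. So everything reduces to [sk 'X^k 1], which vanishes by [moment_ibp]. *)
Lemma mform_skew p q :
  mform (p^`() + p * G) q + mform p (q^`() + q * G) = 0.
Proof.
pose sk p q := mform (p^`() + p * G) q + mform p (q^`() + q * G).
have DX p' : (p' * 'X)^`() + p' * 'X * G = (p'^`() + p' * G) * 'X + p'.
  by rewrite derivM derivX mulr1 -mulrA -commr_polyX mulrA addrAC -mulrDl.
(* By the product rule [DX], both sides carry the same extra term <p', q'>. *)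
have skX p' q' : sk (p' * 'X) q' = sk p' (q' * 'X).
  rewrite /sk !DX (mformDl (_ * 'X)) (mformDr _ (_ * 'X)) !mformXl.
  by rewrite addrAC -addrA.
have skD p1 p2 q' : sk (p1 + p2) q' = sk p1 q' + sk p2 q'.
  by rewrite /sk derivD mulrDl addrACA (mformDl (p1^`() + _)) (mformDl p1) addrACA.
have skDr p' q1 q2 : sk p' (q1 + q2) = sk p' q1 + sk p' q2.
  by rewrite /sk derivD mulrDl addrACA (mformDr _ (q1^`() + _)) (mformDr _ q1) addrACA.
have skZ c q' : sk c%:P q' = c * sk 1%:P q'.
  rewrite /sk !derivC !add0r polyC1 mul1r -[in mform _ (_ + _)](mulr1 c%:P).
  by rewrite !mul_polyC !mformZl -mulrDr.
have skZr c p' : sk p' c%:P = sk p' 1%:P * c^t*.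
  rewrite /sk !derivC !add0r polyC1 mul1r -[in mform (_ + _) _](mulr1 c%:P).
  by rewrite !mul_polyC !mformZr -mulrDl.
have skXn k : sk 'X^k 1%:P = 0.
  rewrite -[RHS](moment_ibp k) big_split /= /sk derivC add0r polyC1 mul1r.
  rewrite mformDl -addrA -!mform_Xn_r; congr (_ + _); last congr (_ + _).
  - by rewrite derivXn mformMnl mform_Xn_1.
  - by rewrite -commr_polyXn mformXnl mul1r.
  - rewrite -mform_adj mform_Xn_r ctrmx_sum; apply: eq_bigr => r _.
    by rewrite ctrmxM mu_adj addnC.
(* The exponent k stays general in the induction, because moving X off q' raises it. *)
have skXnq k q' : sk 'X^k q' = 0.
  elim/poly_ind: q' k => [|q' c IH] k.
    by rewrite /sk -polyC0 -/(sk _ _) skZr skXn mul0r.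
  by rewrite skDr -skX -exprSr IH skZr skXn mul0r addr0.
rewrite -/(sk p q); elim/poly_ind: p q => [|p c IH] q.
  by rewrite -polyC0 skZ mul0r.
by rewrite skD skX IH skZ polyC1 -(expr0 'X) skXnq mulr0 addr0.
Qed.

End MomentForm.

(** * Orthogonal polynomials *)

Section OrthogonalPolynomials.
Context {C : numClosedFieldType} {N : nat}.
Variable mu : nat -> 'M[C]_N.+1.
Hypothesis mu_adj : forall k, (mu k)^t* = mu k.
Variables (P : nat -> {poly 'M[C]_N.+1}) (g : nat -> 'M[C]_N.+1).
Hypothesis P_monic : forall n, P n \is monic.
Hypothesis size_P : forall n, size (P n) = n.+1.
Hypothesis P_orth : forall n (q : {poly _}), (size q <= n)%N -> mform mu (P n) q = 0.
Let h n := mform mu (P n) (P n).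
Hypothesis hg : forall n, h n * g n = 1.
Hypothesis gh : forall n, g n * h n = 1.
Implicit Types (p q : {poly 'M[C]_N.+1}) (n : nat).

Local Notation "<< p , q >>" := (mform mu p q).

Lemma norm_adj n : (h n)^t* = h n.
Proof. exact: mform_adj. Qed.

Lemma inv_norm_adj n : (g n)^t* = g n.
Proof.
by rewrite -[LHS]mulr1 -(hg n) mulrA -[in X in X * _](norm_adj n) -ctrmxM hg ctrmx1 mul1r.
Qed.

Lemma orth_r n q : (size q <= n)%N -> << q, P n >> = 0.
Proof. by move=> hq; rewrite -(mform_adj mu_adj) P_orth// ctrmx0. Qed.

Lemma coef_P n : (P n)`_n = 1.
Proof. by have /monicP := P_monic n; rewrite lead_coefE size_P. Qed.

Lemma size_sub_lead n p : (size p <= n.+1)%N ->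
  (size (p - p`_n *: P n)%R <= n)%N.
Proof.
move=> hp; apply/leq_sizeP => j; rewrite leq_eqVlt coefB coefZ => /predU1P[<-|hj].
  by rewrite coef_P mulr1 subrr.
rewrite [p`_j]nth_default ?(leq_trans hp)// [(P n)`_j]nth_default ?size_P//.
by rewrite mulr0 subrr.
Qed.

(** Subtracting p_n P_n from p leaves degree below n, which is orthogonal to P_n. *)
Lemma mform_lead n p : (size p <= n.+1)%N -> << p, P n >> = p`_n * h n.
Proof.
move=> /size_sub_lead /orth_r.
by rewrite mformBl mformZl => /eqP; rewrite subr_eq0 => /eqP.
Qed.

(** Pairing with the P_k from the top degree down kills the coefficients one by one, since each norm
    [h k] is invertible. *)
Lemma mform_nondegenerate n q : (size q <= n)%N ->
  (forall p, (size p <= n)%N -> << q, p >> = 0) -> q = 0.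
Proof.
elim: n q => [|n IH] q hq q_orth; first by apply/eqP; rewrite -size_poly_leq0.
have q_n : q`_n = 0.
  have := mform_lead hq; rewrite q_orth ?size_P// => /(congr1 ( *%R^~ (g n))).
  by rewrite mul0r -mulrA hg mulr1.
apply: IH => [|p hp]; last by rewrite q_orth// ltnW.
by have := size_sub_lead hq; rewrite q_n scale0r subr0.
Qed.

(** This is alpha_n: the shift by X gives a_{n,n-1}, with the correct value 0 at n = 0. *)
Definition rec_diag n := (P n * 'X)`_n - (P n.+1)`_n.
(** The whole term beta_n P_{n-1}, so that it is 0 at n = 0. *)
Definition rec_prev n :=
  if n is n'.+1 then (h n * g n') *: P n' else 0.

Lemma size_mulX p n : (size p <= n)%N -> (size (p * 'X)%R <= n.+1)%N.
Proof.
move=> hp; apply: (leq_trans (size_polyMleq _ _)).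
by rewrite size_polyX addn2.
Qed.

(** The difference of the two sides has degree below n and is orthogonal to all polynomials of
    degree below n, hence is zero by [mform_nondegenerate]. *)
Lemma three_term n :
  P n * 'X = P n.+1 + rec_diag n *: P n + rec_prev n.
Proof.
pose Q := P n * 'X - P n.+1.
have hQ : (size Q <= n.+1)%N.
  apply/leq_sizeP => j; rewrite leq_eqVlt coefB coefMX => /predU1P[<-|hj].
    by rewrite /= !coef_P subrr.
  case: j hj => // j hj /=.
  by rewrite !nth_default ?subrr// size_P.
have Q_n : Q`_n = rec_diag n by rewrite coefB.
suff /eqP : Q - rec_diag n *: P n - rec_prev n = 0.
  by rewrite /Q !subr_eq0 !subr_eq => /eqP ->; rewrite addrC addrA addrAC addrC addrA.
apply: (@mform_nondegenerate n).
  rewrite -Q_n (leq_trans (size_polyD _ _))// geq_max size_sub_lead// size_polyN.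
  rewrite /rec_prev; case: (n) => [|n'] //=; first by rewrite size_poly0.
  by rewrite (leq_trans (size_scale_leq _ _)) ?size_P.
move=> p hp; rewrite !mformBl mformZl (P_orth hp) mulr0 subr0.
rewrite (P_orth (leqW hp)) subr0 mformXl.
case: n p hp {Q hQ Q_n} => [|n] p hp /=.
  rewrite mform0l subr0 P_orth//.
  by move: hp; rewrite size_poly_leq0 => /eqP ->; rewrite mul0r size_poly0.
(* Both terms equal h_{n+1} p_n^*: the first is <P_{n+1}, p X>, and in the second g_n cancels the
   h_n coming from <P_n, p>. *)
rewrite mformZl -(mform_adj mu_adj (p * 'X)) -(mform_adj mu_adj p).
rewrite (mform_lead (size_mulX hp)) (mform_lead hp) coefMX /=.
by rewrite !ctrmxM !norm_adj mulrA -(mulrA _ (g n)) gh mulr1 subrr.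
Qed.

(** As X is symmetric, alpha_n h_n = <P_n X, P_n> is Hermitian; multiply by g_n on both sides. *)
Lemma rec_diag_adj n : (rec_diag n)^t* * g n = g n * rec_diag n.
Proof.
have e : rec_diag n * h n = << P n * 'X, P n >>.
  rewrite three_term !mformDl mformZl (@P_orth n.+1) ?size_P// add0r.
  rewrite (_ : << rec_prev n, _ >> = 0) ?addr0//.
  case: n => [|n] /=; first by rewrite mform0l.
  by rewrite mformZl orth_r ?mulr0// size_P.
have := congr1 (fun A => A^t*) e.
rewrite (mform_adj mu_adj) -mformXl -e ctrmxM norm_adj => e2.
by rewrite -[LHS]mul1r -(gh n) mulrA -(mulrA (g n)) e2 -!mulrA hg mulr1.
Qed.

Variable z : C.
Local Notation w := (z%:M : 'M[C]_N.+1).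
Local Notation w' := (z^*%:M : 'M[C]_N.+1).
Let E n := ((P n).[w])^t*.

Definition kern n := \sum_(k < n) (E k * g k) *: P k.

(** Induction on the degree: the last summand of the kernel contributes p_n h_n g_n P_n(z) = p_n
    P_n(z), and p - p_n P_n is covered by the smaller kernel. *)
Lemma kern_reproducing n p : (size p <= n)%N -> << p, kern n >> = p.[w].
Proof.
elim: n p => [|n IH] p hp.
  move: hp; rewrite size_poly_leq0 => /eqP ->.
  by rewrite mform0l horner0.
rewrite /kern big_ord_recr /= -/(kern n) (mformDr mu_adj) (mformZr mu_adj).
rewrite ctrmxM inv_norm_adj trmxCK (mform_lead hp) !mulrA.
rewrite -(mulrA p`_n) hg mulr1.
have := IH _ (size_sub_lead hp).
rewrite mformBl mformZl hornerD hornerN hornerZ => /eqP.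
rewrite (_ : << P n, kern n >> = 0) ?mulr0 ?subr0.
  by rewrite eq_sym subr_eq eq_sym => /eqP.
rewrite P_orth// (leq_trans (size_sum _ _ _))//; apply/bigmax_leqP => k _.
by rewrite (leq_trans (size_scale_leq _ _))// size_P.
Qed.

Lemma scalar_mxCr (a : C) (A : 'M[C]_N.+1) : A * a%:M = a%:M * A.
Proof. exact: scalar_mxC. Qed.

(** Each summand is expanded by the recurrence for P_k(X) and by the adjoint recurrence at z. The
    alpha terms cancel by [rec_diag_adj] and the rest telescopes. The conjugate point appears
    because the kernel contains P_k(z)^*. *)
Lemma christoffel_darboux n :
  kern n.+1 * ('X - w'%:P) =
  (E n * g n) *: P n.+1 - (E n.+1 * g n) *: P n.
Proof.
have pw' p : p * w'%:P = w' *: p.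
  by apply/polyP => i; rewrite coefMC coefZ scalar_mxCr.
have step k : ((E k * g k) *: P k) * ('X - w'%:P) =
   ((E k * g k) *: P k.+1 - (E k.+1 * g k) *: P k) +
   ((E k * g k) *: rec_prev k - (((rec_prev k).[w])^t* * g k) *: P k).
  have e : w' * E k = E k.+1 + E k * (rec_diag k)^t* + ((rec_prev k).[w])^t*.
    rewrite /E -ctrmxM -!ctrmxD -hornerZ -!hornerD -three_term hornerMX.
    by rewrite ctrmxM ctrmx_scalar.
  rewrite mulrBr pw' -scalerAl three_term !scalerDr !scalerA mulrA e.
  rewrite !mulrDl !scalerDl -(mulrA (E k)) rec_diag_adj mulrA.
  move: (_ *: P k.+1) (_ *: rec_prev k) (_ *: P k) (_ *: P k) (_ *: P k) => a c b d f.
  by rewrite (addrAC a) (addrAC d) opprD addrACA subrr addr0 opprD addrACA.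
elim: n => [|n IH].
  by rewrite /kern big_ord1 step /= horner0 ctrmx0 mul0r scaler0 scale0r subrr addr0.
rewrite /kern big_ord_recr /= -/(kern n.+1) mulrDl IH step /=.
(* Since beta_{n+1} = h_{n+1} g_n, the beta terms of step n+1 are exactly the negative of the closed
   form for n. *)
rewrite hornerZ !ctrmxM inv_norm_adj norm_adj !scalerA -!mulrA hg mulr1.
rewrite [g n.+1 * (_ * _)]mulrA gh mul1r -/(E n) addrCA -[in RHS](addr0 (_ - _)).
by congr (_ + _); rewrite addrA subrK subrr.
Qed.

Variable G : {poly 'M[C]_N.+1}.
Hypothesis mform_skew : forall p q,
  << p^`() + p * G, q >> + << p, q^`() + q * G >> = 0.

(* With kernel k, the right-hand side is -<d_w F, (X - w') k> - <P, d_w' ((X - w') k G)>: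
   moving the factor X - w' across the form cancels both divided differences. *)
Lemma lowering_form n :
  let F k := P k * G in
  (P n.+1)^`().[w] + (F n.+1).[w] =
  (<< divdiff w (F n.+1), P n >> + << P n.+1, divdiff w' (F n) >>)
    * g n * (P n.+1).[w]
  - (<< divdiff w (F n.+1), P n.+1 >> + << P n.+1, divdiff w' (F n.+1) >>)
    * g n * (P n).[w].
Proof.
move=> F; set K := kern n.+1; set d := divdiff w (F n.+1).
have dK : K * ('X - w'%:P) * G = (E n * g n) *: F n.+1 - (E n.+1 * g n) *: F n.
  by rewrite christoffel_darboux mulrBl !scalerAl.
have pw a p : p * (a%:M)%:P = a%:M *: p.
  by apply/polyP => i; rewrite coefMC coefZ scalar_mxCr.
have KG : K * G * ('X - w'%:P) = (E n * g n) *: F n.+1 - (E n.+1 * g n) *: F n.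
  by rewrite -dK !mulrBr mulrBl !pw -scalerAl -[K * 'X * G]mulrA -commr_polyX mulrA.
(* K G (X - zbar) vanishes at zbar, so K G is its own divided difference there; this is why the
   constant 0 is passed to [divdiff_uniq]. *)
have dKG : K * G =
    (E n * g n) *: divdiff w' (F n.+1) - (E n.+1 * g n) *: divdiff w' (F n).
  rewrite -!divdiffZ -divdiffB; apply: (@divdiff_uniq _ _ _ _ 0).
    by rewrite KG subr0.
  by apply/esym/rootP/factor_theorem; exists (K * G).
have size_K : (size K <= n.+1)%N.
  rewrite (leq_trans (size_sum _ _ _))//; apply/bigmax_leqP => k _.
  by rewrite (leq_trans (size_scale_leq _ _))// size_P.
have adjX p q : << p * ('X - w%:P), q >> = << p, q * ('X - w'%:P) >>.
  rewrite !mulrBr !pw mformBl (mformBr mu_adj) mformXl mformZl (mformZr mu_adj).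
  by rewrite ctrmx_scalar conjCK scalar_mxCr.
(* Moving X - zbar across the form turns d into F - F(z), and the kernel reproduces the constant
   F(z). *)
have rhs1 : (F n.+1).[w] + << d, (E n * g n) *: P n.+1 - (E n.+1 * g n) *: P n >>
    = << F n.+1, K >>.
  rewrite -christoffel_darboux -adjX divdiffP mformBl -(mulr1 (_%:P)) mul_polyC mformZl.
  by rewrite (@kern_reproducing _ 1) ?size_poly1// hornerC mulr1 addrC subrK.
have mformE k l p q : << p, (E k * g l) *: q >> = << p, q >> * g l * (P k).[w].
  by rewrite (mformZr mu_adj) ctrmxM inv_norm_adj trmxCK mulrA.
(* The kernel reproduces degree at most n, hence P_{n+1}'; and <P_{n+1}, K'> = 0 by degree. *)
have := mform_skew (P n.+1) K; rewrite mformDl (mformDr mu_adj).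
rewrite kern_reproducing; last first.
  by rewrite -ltnS -(size_P n.+1) lt_size_deriv// monic_neq0.
rewrite P_orth ?add0r; last first.
  by rewrite (leq_trans (size_poly _ _))// (leq_trans (leq_pred _)).
rewrite -rhs1 dKG !(mformBr mu_adj) !mformE -/(F n.+1) => skew0.
apply/eqP; rewrite -subr_eq0 -skew0 !mulrDl opprB opprD -!addrA; apply/eqP.
by congr (_ + (_ + (_ + _))); rewrite addrCA.
Qed.

End OrthogonalPolynomials.

(** * Integration *)

Section RealIntegrals.
Local Open Scope classical_set_scope.
Context {R : realType}.
Local Notation leb := (@lebesgue_measure R).

(** Otherwise |f| >= e on a set of infinite measure, and the integral of |f| would be infinite. *)
Lemma integrable_small_value (A : set R) (f : R -> R) (e : R) :
  measurable A -> leb A = +oo%E -> leb.-integrable A (EFin \o f) -> 0 < e ->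
  exists2 x, A x & `|f x| < e.
Proof.
move=> mA Aoo intf e0; apply: contrapT => nex.
have fe x : A x -> e <= `|f x|.
  by move=> Ax; rewrite leNgt; apply/negP => fx; apply: nex; exists x.
have /integrableP[mf] := intf; rewrite ltNge => /negP; apply.
rewrite -(@gt0_mulye R e%:E) ?lte_fin// muleC -Aoo -integral_cst//.
apply: ge0_le_integral => //.
- by move=> x _; rewrite lee_fin ltW.
- by have /measurable_int := integrable_abse intf.
Qed.

(** This disposes of the boundary terms in integration by parts: finite moments give integrability,
    but no pointwise decay at infinity. *)
Lemma Rintegral_derive_eq0 (f : R -> R) :
  (forall x, derivable f x 1) -> continuous (derive1 f) ->
  leb.-integrable setT (EFin \o f) -> leb.-integrable setT (EFin \o (derive1 f)) ->
  \int[leb]_x (derive1 f) x = 0.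
Proof.
move=> df cf' intf intf'.
have inv_gt0 n : (0 : R) < n.+1%:R^-1 by rewrite invr_gt0.
(* As f is integrable, it is small at suitable endpoints b_n -> +oo and
   a_n -> -oo; dominated convergence then applies on [a_n, b_n]. *)
have /choice[b bP] n : exists x, n%:R <= x /\ `|f x| < n.+1%:R^-1.
  have [||||x] := @integrable_small_value `[n%:R, +oo[ f n.+1%:R^-1 => //.
  - by rewrite lebesgue_measure_itv/= ltry.
  - exact: integrableS intf.
  - by rewrite /= in_itv/= andbT; exists x.
have /choice[a aP] n : exists x, x <= - n%:R /\ `|f x| < n.+1%:R^-1.
  have [||||x] := @integrable_small_value `]-oo, - n%:R] f n.+1%:R^-1 => //.
  - by rewrite lebesgue_measure_itv/= ltNyr.
  - exact: integrableS intf.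
  - by rewrite /= in_itv/=; exists x.
(* The index n+1 forces a < 0 < b; at index 0 the two endpoints could coincide. *)
pose u n x := (((derive1 f) \_ `[a n.+1, b n.+1]) x)%:E.
have uE n : (\int[leb]_x u n x)%E = (f (b n.+1) - f (a n.+1))%:E.
  have ab : a n.+1 < b n.+1.
    rewrite (le_lt_trans (aP _).1)// (lt_le_trans _ (bP _).1)//.
    by rewrite (@lt_trans _ _ 0)// oppr_lt0.
  transitivity (\int[leb]_(x in `[a n.+1, b n.+1]) (derive1 f x)%:E)%E.
    rewrite [RHS]integral_mkcond; apply: eq_integral => x _.
    by rewrite restrict_EFin.
  rewrite EFinB; apply: continuous_FTC2 => //.
  - by apply: continuous_subspaceT.
  - have cf x : {for x, continuous f}.
      by apply/differentiable_continuous/derivable1_diffP.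
    by split => //; [apply: cvg_at_right_filter|apply: cvg_at_left_filter]; exact: cf.
have [|||||_ _] := @dominated_convergence _ _ _ leb setT measurableT u
    (EFin \o derive1 f) (abse \o (EFin \o derive1 f)).
- move=> n; apply/measurable_EFinP; apply/(measurable_restrictT _ _).1 => //.
  apply: measurable_funTS; apply/measurable_EFinP; exact: measurable_int intf'.
- exact: measurable_int intf'.
- apply: aeW => x _; apply: cvg_near_cst; near=> n.
  have xn : `|x| <= n.+1%:R.
    apply: (@le_trans _ _ n%:R); last by rewrite ler_nat.
    by near: n; exact: nbhs_infty_ger.
  rewrite /u patchE mem_set//= in_itv/=; move: xn; rewrite ler_norml => /andP[xa xb].
  by rewrite (le_trans (aP _).1 xa) (le_trans xb (bP _).1).
- exact: integrable_abse.
- apply: aeW => x n _; rewrite /u /= lee_fin patchE.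
  by case: ifP => _; rewrite ?normr0.
move=> h1.
have h2 : (\int[leb]_x u n x)%E @[n --> \oo] --> 0%:E.
  have cvg0 (c : nat -> R) : (forall n, `|f (c n)| < n.+1%:R^-1) ->
      f (c n.+1) @[n --> \oo] --> (0 : R).
    move=> cP; apply/cvgr0Pnorm_lt => e e0; near=> n.
    apply: (lt_trans (cP _)); apply: (@le_lt_trans _ _ n.+1%:R^-1).
      by rewrite lef_pV2 ?posrE// ler_nat.
    by near: n; exact: (near_infty_natSinv_lt (PosNum e0)).
  rewrite (_ : (fun n => _) = (fun n => (f (b n.+1) - f (a n.+1))%:E)); last exact/funext.
  apply: cvg_EFin; first exact: nearW.
  rewrite -[X in _ --> X](subr0 (0 : R)); apply: cvgB; apply: cvg0 => n.
  - by have [] := bP n.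
  - by have [] := aP n.
have := cvg_unique _ h1 h2.
by rewrite /Rintegral => ->.
Unshelve. all: by end_near. Qed.

End RealIntegrals.

(** * Integrals of complex matrix-valued functions *)

Section ComplexIntegrals.
Context {R : realType}.
Local Notation leb := (@lebesgue_measure R).

Lemma Re_sum (I : Type) (r : seq I) (F : I -> R[i]) :
  complex.Re (\sum_(t <- r) F t) = \sum_(t <- r) complex.Re (F t).
Proof. by apply: (big_morph (@complex.Re R)) => // -[a b] [c d]. Qed.

Lemma Im_sum (I : Type) (r : seq I) (F : I -> R[i]) :
  complex.Im (\sum_(t <- r) F t) = \sum_(t <- r) complex.Im (F t).
Proof. by apply: (big_morph (@complex.Im R)) => // -[a b] [c d]. Qed.

Lemma Re_mulC (c : R[i]) (r : R) : complex.Re (c * (r%:C)%C) = complex.Re c * r.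
Proof. by case: c => a b /=; rewrite mulr0 subr0. Qed.

Lemma Im_mulC (c : R[i]) (r : R) : complex.Im (c * (r%:C)%C) = complex.Im c * r.
Proof. by case: c => a b /=; rewrite mulr0 add0r. Qed.

Lemma complex_sum (I : Type) (r : seq I) (F : I -> R[i]) :
  (complex.Re (\sum_(t <- r) F t) +i* complex.Im (\sum_(t <- r) F t))%C
    = \sum_(t <- r) F t.
Proof. by case: (\sum_(t <- r) F t). Qed.

Lemma integrable_lincomb (I : Type) (s : seq I) (c : I -> R) (r : I -> R -> R) :
  (forall t, leb.-integrable setT (EFin \o r t)) ->
  leb.-integrable setT (EFin \o (fun x => \sum_(t <- s) c t * r t x)).
Proof.
move=> intr.
rewrite (_ : EFin \o _ = (fun x => \sum_(t <- s) (c t)%:E * (EFin \o r t) x)%E).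
  by apply: integrable_sum => // t _; apply: integrableZl.
by apply/funext => x /=; rewrite -sumEFin; apply: eq_bigr => t _; rewrite EFinM.
Qed.

Lemma Rintegral_lincomb (I : Type) (s : seq I) (c : I -> R) (r : I -> R -> R) :
  (forall t, leb.-integrable setT (EFin \o r t)) ->
  \int[leb]_x (\sum_(t <- s) c t * r t x) = \sum_(t <- s) c t * \int[leb]_x r t x.
Proof.
move=> intr; elim: s => [|t s IH].
  under eq_Rintegral do rewrite big_nil.
  by rewrite big_nil Rintegral_cst// mul0r.
under eq_Rintegral do rewrite big_cons.
rewrite big_cons RintegralD//.
- by rewrite IH RintegralZl.
- have := @integrable_lincomb _ [:: t] c r intr.
  by apply: eq_integrable => // x _ /=; rewrite big_seq1.
- exact: integrable_lincomb.
Qed.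

End ComplexIntegrals.

Section MatrixIntegral.
Context {R : realType} {N : nat}.
Local Notation leb := (@lebesgue_measure R).
Local Notation C := R[i].

Definition rmxintegral (f : R -> 'M[R]_N.+1) : 'M[R]_N.+1 :=
  \matrix_(i, j) \int[leb]_x f x i j.

(** Flattening the products leaves constant complex coefficients times real functions, so real and
    imaginary parts become real linear combinations. *)
Lemma mxsandwich_entry (I : finType) (F : I -> 'M[R]_N.+1) (A B : I -> 'M[C]_N.+1) i j :
  (\sum_s A s *m cmx (F s) *m B s) i j =
  \sum_(t : I * ('I_N.+1 * 'I_N.+1))
    (A t.1 i t.2.1 * B t.1 t.2.2 j) * ((F t.1 t.2.1 t.2.2)%:C)%C.
Proof.
rewrite summxE -(pair_bigA _ (fun s kl =>
  A s i kl.1 * B s kl.2 j * ((F s kl.1 kl.2)%:C)%C)) /=.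
apply: eq_bigr => s _.
rewrite -(pair_bigA _ (fun k l => A s i k * B s l j * ((F s k l)%:C)%C)) /=.
rewrite exchange_big mxE.
apply: eq_bigr => l _ /=; rewrite mxE mulr_suml; apply: eq_bigr => k _.
by rewrite !mxE mulrAC.
Qed.

Section Sandwich.
Context {I : finType} (f : I -> R -> 'M[R]_N.+1) (A B : I -> 'M[C]_N.+1).
Hypothesis intf : forall s i j, leb.-integrable setT (EFin \o (fun x => f s x i j)).
Let F x := \sum_s A s *m cmx (f s x) *m B s.

Lemma mxintegral_sandwich :
  mxintegral F = \sum_s A s *m cmx (rmxintegral (f s)) *m B s.
Proof.
apply/matrixP => i j; rewrite mxsandwich_entry mxE -[RHS]complex_sum.
congr (_ +i* _)%C.
- rewrite Re_sum; under [RHS]eq_bigr do rewrite Re_mulC mxE.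
  rewrite -(Rintegral_lincomb _ _ (r := fun t x => f t.1 x t.2.1 t.2.2))//.
  apply: eq_Rintegral => x _; rewrite mxE mxsandwich_entry Re_sum.
  by apply: eq_bigr => t _; rewrite Re_mulC.
- rewrite Im_sum; under [RHS]eq_bigr do rewrite Im_mulC mxE.
  rewrite -(Rintegral_lincomb _ _ (r := fun t x => f t.1 x t.2.1 t.2.2))//.
  apply: eq_Rintegral => x _; rewrite mxE mxsandwich_entry Im_sum.
  by apply: eq_bigr => t _; rewrite Im_mulC.
Qed.

Lemma integrable_Re_sandwich i j :
  leb.-integrable setT (EFin \o (fun x => Remx F x i j)).
Proof.
rewrite (_ : (fun x => _) = fun x => \sum_(t : I * ('I_N.+1 * 'I_N.+1))
  complex.Re (A t.1 i t.2.1 * B t.1 t.2.2 j) * f t.1 x t.2.1 t.2.2).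
  exact: (integrable_lincomb _ _ (r := fun t x => f t.1 x t.2.1 t.2.2)).
apply/funext => x; rewrite mxE mxsandwich_entry Re_sum.
by apply: eq_bigr => t _; rewrite Re_mulC.
Qed.

End Sandwich.
End MatrixIntegral.

(** * Moments of the weight *)

Section Moments.
Context {R : realType} {N : nat}.
Variable W : R -> 'M[R]_N.+1.
Hypothesis hW : is_weight W.
Local Notation leb := (@lebesgue_measure R).
Local Notation C := R[i].
Implicit Types p q : {poly 'M[C]_N.+1}.

Definition moment k : 'M[C]_N.+1 := cmx (rmxintegral (fun x => x ^+ k *: W x)).

Lemma mxeval_real p (x : R) :
  mxeval p (x%:C)%C = \sum_(i < size p) p`_i *m ((x ^+ i)%:C)%C%:M.
Proof.
rewrite /mxeval horner_coef; apply: eq_bigr => i _.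
by rewrite !rmorphXn.
Qed.

Lemma cmxZ (a : R) (A : 'M[R]_N.+1) : cmx (a *: A) = (a%:C)%C *: cmx A.
Proof. exact: map_mxZ. Qed.

Lemma ctrmx_real (x : R) : (((x%:C)%C)%:M : 'M[C]_N.+1)^t* = ((x%:C)%C)%:M.
Proof. by rewrite ctrmx_scalar -[RHS](congr1 _ (conjc_real x)). Qed.

Lemma weight_sandwich p q (x : R) :
  mxeval p (x%:C)%C *m cmx (W x) *m (mxeval q (x%:C)%C)^t* =
  \sum_(s : 'I_(size p) * 'I_(size q))
    p`_s.1 *m cmx (x ^+ (s.1 + s.2) *: W x) *m (q`_s.2)^t*.
Proof.
rewrite !mxeval_real -(pair_bigA _ (fun (i : 'I_(size p)) (j : 'I_(size q)) =>
  p`_i *m cmx (x ^+ (i + j) *: W x) *m (q`_j)^t*)) /= !mulmx_suml.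
apply: eq_bigr => i _; rewrite ctrmx_sum mulmx_sumr; apply: eq_bigr => j _.
rewrite [(_ *m _)^t*]ctrmxM ctrmx_real cmxZ exprD rmorphM /=.
rewrite -[_%:M * _]/(_ *m _) mul_scalar_mx mul_mx_scalar.
by rewrite -!scalemxAr -!scalemxAl scalerA mulrC.
Qed.

Lemma integrable_moment k i j :
  leb.-integrable setT (EFin \o (fun x => (x ^+ k *: W x) i j)).
Proof.
have [_ _ _ finW _] := hW; have := finW k i j.
by apply: eq_integrable => // x _ /=; rewrite mxE.
Qed.

(** The bridge from integrals to the algebraic form. *)
Lemma wprodE p q : wprod W p q = mform moment p q.
Proof.
rewrite /wprod (funext (weight_sandwich p q)).
rewrite mxintegral_sandwich; last by move=> *; exact: integrable_moment.
by rewrite /mform pair_bigA.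
Qed.

(** The default value b_{n,k} = 0 for k < n agrees with orthogonality, so one formula serves all
    natural k. *)
Lemma coef_bE P n (k : nat) : (forall q, (size q <= n)%N -> wprod W (P n) q = 0) ->
  coef_b W P n k%:Z = wprod W (P n) 'X^k.
Proof.
move=> Porth; rewrite /coef_b /=; case: leqP => nk; last first.
  by rewrite Porth// size_polyXn.
congr mxintegral; apply/funext => x.
have -> : mxeval 'X^k (x%:C)%C = (((x ^+ k)%:C)%C)%:M :> 'M[C]_N.+1.
  by rewrite /mxeval hornerXn !rmorphXn.
by rewrite ctrmx_real mul_mx_scalar rmorphXn.
Qed.

Lemma moment_adj k : (moment k)^t* = moment k.
Proof.
apply/matrixP => i j; rewrite !mxE /= -[LHS]/(conjc _) conjc_real; congr (_%:C)%C.
apply: eq_Rintegral => x _; rewrite !mxE.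
case: hW => _ _ /(_ x)[Wsym _] _ _.
by rewrite -[in LHS]Wsym mxE.
Qed.

Lemma derivable_weight x i j : derivable (fun x => W x i j) x 1.
Proof. by case: hW => /(_ 0%N x)/derivable_mxP. Qed.

Lemma derive1_weight x i j : derive1 W x i j = derive1 (fun x => W x i j) x.
Proof.
rewrite !derive1E derive_mx ?mxE//.
by case: hW => /(_ 0%N x).
Qed.

Lemma continuous_derive1_weight i j : continuous (fun x => derive1 W x i j).
Proof.
move=> x; apply/differentiable_continuous/derivable1_diffP.
by case: hW => /(_ 1%N x)/derivable_mxP.
Qed.

Lemma integrable_derive_moment k i j :
  leb.-integrable setT (EFin \o (fun x => (x ^+ k *: derive1 W x) i j)).
Proof.
have [_ _ _ _ finW] := hW; have := finW k i j.
by apply: eq_integrable => // x _ /=; rewrite mxE.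
Qed.

(** The integral of (x^k W)' vanishes entrywise. At k = 0 the truncated predecessor is harmless
    because its term is multiplied by 0. *)
Lemma moment_derive k : rmxintegral (fun x => x ^+ k.-1 *: W x) *+ k +
  rmxintegral (fun x => x ^+ k *: derive1 W x) = 0.
Proof.
apply/matrixP => i j; rewrite mxE mulmxnE !mxE.
pose f (x : R) := x ^+ k * W x i j.
have df (x : R) : is_derive x (1 : R) f
    (k%:R * (x ^+ k.-1 * W x i j) + x ^+ k * derive1 W x i j).
  have dW : is_derive x (1 : R) (fun x => W x i j) (derive1 W x i j).
    by rewrite derive1_weight derive1E; apply/derivableP/derivable_weight.
  have dX : is_derive x (1:R) (fun x => x ^+ k) (k%:R * x ^+ k.-1).
    apply: DeriveDef; first exact: exprn_derivable.
    by rewrite exp_derive /GRing.scale /= mulr1.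
  have := is_deriveM dX dW; congr is_derive.
  by rewrite /GRing.scale /= addrC; congr (_ + _); rewrite mulrC mulrA.
have f'E : derive1 f = fun x => k%:R * (x ^+ k.-1 * W x i j) + x ^+ k * derive1 W x i j.
  by apply/funext => x; rewrite derive1E; exact: derive_val.
have [_ _ _ finW finW'] := hW.
have intW : leb.-integrable setT (EFin \o (fun x => k%:R * (x ^+ k.-1 * W x i j))).
  exact: (integrableZl _ _ (finW k.-1 i j)).
have : \int[leb]_x derive1 f x = 0.
  apply: Rintegral_derive_eq0.
  - by move=> x; have [] := df x.
  - rewrite f'E => x; apply: cvgD; apply: cvgM.
    + exact: cvg_cst.
    + apply: cvgM; first exact: exprn_continuous.
      exact/differentiable_continuous/derivable1_diffP/derivable_weight.
    + exact: exprn_continuous.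
    + exact: continuous_derive1_weight.
  - exact: finW.
  - rewrite f'E; exact: (integrableD _ intW (finW' k i j)).
rewrite f'E RintegralD//; last exact: finW'.
rewrite RintegralZl//; last exact: finW.
rewrite mulr_natl => <-; congr (_ *+ _ + _); apply: eq_Rintegral => x _; by rewrite mxE.
Qed.

End Moments.

(** * The Pearson equation W' = G W + W G^* and its moments *)

Section Pearson.
Context {R : realType} {N : nat}.
Variables (W : R -> 'M[R]_N.+1) (T : R -> 'M[R[i]]_N.+1) (G : {poly 'M[R[i]]_N.+1}).
Hypothesis hW : is_weight W.
Hypothesis hT : csmooth T.
Hypothesis hWT : forall x : R, cmx (W x) = T x *m (T x) ^t*.
Hypothesis hTG : forall x : R, cderive1 T x = mxeval G (x%:C)%C *m T x.
Local Notation C := R[i].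

Lemma is_derive_Remx i k (x : R) :
  is_derive x (1 : R) (fun y => complex.Re (T y i k)) (complex.Re (cderive1 T x i k)).
Proof.
case: hT => /(_ 0%N x) /= dT _.
rewrite mxE /= derive1E derive_mx// mxE.
rewrite (_ : (fun y => complex.Re (T y i k)) = fun y => Remx T y i k).
  by apply/derivableP; move/derivable_mxP: dT.
by apply/funext => y; rewrite mxE.
Qed.

Lemma is_derive_Immx i k (x : R) :
  is_derive x (1 : R) (fun y => complex.Im (T y i k)) (complex.Im (cderive1 T x i k)).
Proof.
case: hT => _ /(_ 0%N x) /= dT.
rewrite mxE /= derive1E derive_mx// mxE.
rewrite (_ : (fun y => complex.Im (T y i k)) = fun y => Immx T y i k).
  by apply/derivableP; move/derivable_mxP: dT.
by apply/funext => y; rewrite mxE.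
Qed.

Lemma ReD (z w : C) : complex.Re (z + w) = complex.Re z + complex.Re w.
Proof. by case: z w => [a b] [c d]. Qed.

Lemma ImD (z w : C) : complex.Im (z + w) = complex.Im z + complex.Im w.
Proof. by case: z w => [a b] [c d]. Qed.

Lemma Re_mulJ (z w : C) :
  complex.Re (z * w^*) = complex.Re z * complex.Re w + complex.Im z * complex.Im w.
Proof. by case: z w => [a b] [c d] /=; rewrite mulrN opprK. Qed.

Lemma Im_mulJ (z w : C) :
  complex.Im (z * w^*) = complex.Im z * complex.Re w - complex.Re z * complex.Im w.
Proof. by case: z w => [a b] [c d] /=; rewrite mulrN addrC. Qed.

Lemma mulmx_adj_entry (A B : 'M[C]_N.+1) i j :
  (A *m B^t*) i j = \sum_k A i k * (B j k)^*.
Proof. by rewrite mxE; apply: eq_bigr => k _; rewrite !mxE. Qed.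

Lemma is_derive_bigsum (n : nat) (f : 'I_n -> R -> R) (df : 'I_n -> R) (x : R) :
  (forall k, is_derive x (1 : R) (f k) (df k)) ->
  is_derive x (1 : R) (fun y => \sum_k f k y) (\sum_k df k).
Proof.
move=> h; have := is_derive_sum h; congr is_derive.
by apply/funext => y; rewrite fct_sumE.
Qed.

(** The product rule for T T^*, carried out on real and imaginary parts because [cderive1] is
    defined through them. *)
Lemma derive1_weight_factor x :
  cmx (derive1 W x) = cderive1 T x *m (T x)^t* + T x *m (cderive1 T x)^t*.
Proof.
apply/matrixP => i j; rewrite mxE derive1_weight// [in RHS]mxE.
rewrite !mulmx_adj_entry -big_split /=.
have WT y : ((W y i j)%:C)%C = \sum_k T y i k * (T y j k)^*.
  by rewrite -mulmx_adj_entry -hWT mxE.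
set a := fun i k y => complex.Re (T y i k).
set b := fun i k y => complex.Im (T y i k).
set a' := fun i k => complex.Re (cderive1 T x i k).
set b' := fun i k => complex.Im (cderive1 T x i k).
have da k l : is_derive x (1 : R) (a k l) (a' k l) by exact: is_derive_Remx.
have db k l : is_derive x (1 : R) (b k l) (b' k l) by exact: is_derive_Immx.
apply/eqP; rewrite eq_complex Re_sum Im_sum; apply/andP; split; apply/eqP.
- rewrite /= (_ : (fun y => W y i j) = fun y =>
      \sum_k (a i k y * a j k y + b i k y * b j k y)).
    rewrite derive1E.
    have h := is_derive_bigsum (fun k =>
      is_deriveD (is_deriveM (da i k) (da j k)) (is_deriveM (db i k) (db j k))).
    rewrite (@derive_val _ _ _ _ _ _ _ h); apply: eq_bigr => k _.
    by rewrite ReD !Re_mulJ -/(a _ _ _) /GRing.scale /= /a /b /a' /b'; ring.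
  apply/funext => y; have /(congr1 (@complex.Re R)) := WT y.
  by rewrite Re_sum => /= ->; apply: eq_bigr => k _; rewrite Re_mulJ.
(* W is real, so the imaginary part of T T^* is identically zero, and so is its derivative. *)
- have h := is_derive_bigsum (fun k =>
    is_deriveB (is_deriveM (db i k) (da j k)) (is_deriveM (da i k) (db j k))).
  have /(congr1 (fun f => 'D_1 f x)) :
      (fun y => \sum_k (b i k * a j k - a i k * b j k) y) = cst 0.
    apply/funext => y; have /(congr1 (@complex.Im R)) := WT y.
    rewrite Im_sum => h0; apply: etrans (esym h0).
    by apply: eq_bigr => k _; rewrite Im_mulJ.
  rewrite (@derive_val _ _ _ _ _ _ _ h) derive_cst => h0; rewrite -[LHS]h0.
  apply: eq_bigr => k _.
  by rewrite ImD !Im_mulJ /GRing.scale /= /a /b /a' /b'; ring.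
Qed.

Lemma weight_pearson (x : R) :
  cmx (derive1 W x) =
  mxeval G (x%:C)%C *m cmx (W x) + cmx (W x) *m (mxeval G (x%:C)%C)^t*.
Proof.
by rewrite derive1_weight_factor hTG [(_ *m T x)^t*]ctrmxM -mulmxA -hWT mulmxA -hWT.
Qed.

Lemma moment_pearson k :
  moment W k.-1 *+ k +
  \sum_(r < size G) (G`_r * moment W (r + k) + moment W (r + k) * (G`_r)^t*) = 0.
Proof.
have /(congr1 (@cmx R N)) := moment_derive hW k.
rewrite /cmx raddf0 raddfD raddfMn /= => ibp; apply: etrans ibp; congr (_ + _).
(* The sum type merges the terms G_r x^(r+k) W and x^(r+k) W G_r^* into one sandwich sum, with the
   identity on the idle side. *)
pose f (s : 'I_(size G) + 'I_(size G)) (x : R) : 'M[R]_N.+1 :=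
  match s with inl r => x ^+ (r + k) *: W x | inr r => x ^+ (r + k) *: W x end.
pose A (s : 'I_(size G) + 'I_(size G)) := if s is inl r then G`_r else 1%:M.
pose B (s : 'I_(size G) + 'I_(size G)) := if s is inr r then (G`_r)^t* else 1%:M.
transitivity (mxintegral (fun x => \sum_s A s *m cmx (f s x) *m B s)).
  rewrite mxintegral_sandwich; last by case=> r i j; exact: integrable_moment.
  rewrite big_sumType /= -big_split /=; apply: eq_bigr => r _.
  by rewrite mulmx1 mul1mx.
rewrite (_ : (fun x => _) = fun x =>
    \sum_(s : 'I_1) 1%:M *m cmx (x ^+ k *: derive1 W x) *m 1%:M).
  rewrite mxintegral_sandwich; last by move=> _ i j; exact: integrable_derive_moment.
  by rewrite big_ord1 mul1mx mulmx1.
apply/funext => x; rewrite big_ord1 mul1mx mulmx1 big_sumType /=.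
rewrite cmxZ weight_pearson scalerDr !mxeval_real ctrmx_sum.
rewrite mulmx_suml mulmx_sumr !scaler_sumr.
congr (_ + _); apply: eq_bigr => r _.
- rewrite mulmx1 cmxZ mul_mx_scalar -scalemxAl -scalemxAr scalerA.
  by rewrite exprD rmorphM /= mulrC.
- rewrite mul1mx cmxZ [(_ *m _)^t*]ctrmxM ctrmx_real -[_%:M * _]/(_ *m _) mul_scalar_mx.
  by rewrite -scalemxAr -scalemxAl scalerA exprD rmorphM /= mulrC.
Qed.

End Pearson.

(** * Positivity of the inner product and invertibility of the norms *)

Section Positivity.
Local Open Scope classical_set_scope.
Context {R : realType} {N : nat}.
Local Notation leb := (@lebesgue_measure R).
Local Notation C := R[i].

Lemma quad_entry (A : 'M[R]_N.+1) (v : 'cV[R]_N.+1) :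
  (v^T *m A *m v) 0 0 = \sum_l \sum_k v k 0 * A k l * v l 0.
Proof.
rewrite mxE; apply: eq_bigr => l _; rewrite mxE mulr_suml.
by apply: eq_bigr => k _; rewrite mxE.
Qed.

(** With row i of Q written as r + i s and A real, the mixed terms in r and s are purely
    imaginary. *)
Lemma Re_quad_entry (A : 'M[R]_N.+1) (Q : 'M[C]_N.+1) i :
  let r := \col_k complex.Re (Q i k) in
  let s := \col_k complex.Im (Q i k) in
  complex.Re ((Q *m cmx A *m Q^t*) i i) =
  (r^T *m A *m r) 0 0 + (s^T *m A *m s) 0 0.
Proof.
move=> r s; rewrite !quad_entry -big_split mxE Re_sum; apply: eq_bigr => l _ /=.
rewrite -big_split mxE mulr_suml Re_sum; apply: eq_bigr => k _ /=.
rewrite !mxE mulrAC Re_mulC Re_mulJ mulrDl.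
by rewrite -!mulrA ![_ * A k l]mulrC.
Qed.

Lemma posdef_quad_ge0 (A : 'M[R]_N.+1) (v : 'cV[R]_N.+1) :
  posdefmx A -> 0 <= (v^T *m A *m v) 0 0.
Proof.
case=> _ Apos; have [->|/Apos/ltW//] := eqVneq v 0.
by rewrite mulmx0 mxE.
Qed.

Lemma posdef_quad_eq0 (A : 'M[R]_N.+1) (v : 'cV[R]_N.+1) :
  posdefmx A -> (v^T *m A *m v) 0 0 = 0 -> v = 0.
Proof.
case=> _ Apos v0; apply/eqP; apply: contraPT v0 => /Apos vpos.
by apply/eqP; rewrite gt_eqF.
Qed.

Variable W : R -> 'M[R]_N.+1.
Hypothesis hW : is_weight W.

Lemma wprod_definite (q : {poly 'M[C]_N.+1}) : wprod W q q = 0 -> q = 0.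
Proof.
(* If q is nonzero, the integrand vanishes at finitely many points only. *)
have [_ _ Wpos _ _] := hW.
move=> qq0; apply/eqP; apply: contraT => q_neq0; exfalso.
(* A nonzero entry (i, j) of the leading coefficient makes the scalar polynomial [pij] nonzero; the
   i-th diagonal entry of the integrand vanishes only where [pij] does. *)
have [i [j lij]] : exists i j, lead_coef q i j != 0.
  apply: contrapT => nex; move: q_neq0; rewrite -lead_coef_eq0 => /eqP; apply.
  apply/matrixP => i j; rewrite mxE; apply: contrapT => /eqP lij.
  by apply: nex; exists i, j.
pose F x := mxeval q (x%:C)%C *m cmx (W x) *m (mxeval q (x%:C)%C)^t*.
pose phi (x : R) := complex.Re (F x i i).
have phi_ge0 x : 0 <= phi x.
  by rewrite /phi Re_quad_entry addr_ge0// posdef_quad_ge0.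
have phi_eq0 x : phi x = 0 -> mxeval q (x%:C)%C i j = 0.
  rewrite /phi Re_quad_entry => /eqP; rewrite paddr_eq0 ?posdef_quad_ge0//.
  move=> /andP[/eqP/(posdef_quad_eq0 (Wpos x)) r0 /eqP/(posdef_quad_eq0 (Wpos x)) s0].
  move/matrixP/(_ j 0): r0; rewrite !mxE => r0.
  move/matrixP/(_ j 0): s0; rewrite !mxE => s0.
  by case: (mxeval q _ i j) r0 s0 => a b /= -> ->.
pose pij : {poly C} := \poly_(s < size q) q`_s i j.
have pijE x : pij.[(x%:C)%C] = mxeval q (x%:C)%C i j.
  rewrite horner_poly mxeval_real summxE; apply: eq_bigr => s _.
  by rewrite mul_mx_scalar mxE mulrC rmorphXn.
have pij_neq0 : pij != 0.
  apply: contraNneq lij => /(congr1 (fun p : {poly C} => p`_(size q).-1)).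
  rewrite coef0 coef_poly prednK ?size_poly_gt0// leqnn => <-.
  by rewrite lead_coefE.
have [rs pijrs] := closed_field_poly_normal pij.
(* The real parts of all roots form a finite set that contains every real root. *)
pose Z := [set` map (@complex.Re R) rs].
have phiZ x : phi x = 0 -> Z x.
  move=> /phi_eq0; rewrite -pijE => px0; apply/mapP; exists (x%:C)%C => //.
  have : root pij (x%:C)%C by apply/rootP.
  by rewrite pijrs rootZ ?lead_coef_eq0// root_prod_XsubC.
have intphi : leb.-integrable setT (EFin \o phi).
  rewrite (_ : phi = fun x => Remx F x i i); last by apply/funext => x; rewrite mxE.
  rewrite /F (funext (weight_sandwich W q q)).
  by apply: integrable_Re_sandwich => *; exact: integrable_moment.
have intphi0 : (\int[leb]_x `|(EFin \o phi) x|)%E = 0%E.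
  have /matrixP/(_ i i) := qq0; rewrite !mxE => /(congr1 (@complex.Re R)) /= h.
  transitivity (\int[leb]_x (EFin \o phi) x)%E.
    by apply: eq_integral => x _; rewrite /= ger0_norm.
  rewrite -[RHS]/(0%:E) -[in RHS]h -[LHS]fineK; last exact: integrable_fin_num.
  by congr (_%:E); apply: eq_Rintegral => x _; rewrite mxE.
have mphi := measurable_int _ intphi.
have [A [mA A0 sA]] := (@ae_eq_integral_abs _ _ _ leb setT measurableT _ mphi).1 intphi0.
have cZ : countable Z by apply: finite_set_countable; exact: finite_seq.
have mZ : measurable Z by apply: countable_measurable => // t; exact: measurable_set1.
(* The real line would be covered by two null sets: [A], outside which phi vanishes, and the finite
   set [Z]. *)
have : (leb [set: R] <= leb (A `|` Z))%E.
  apply: le_measure; rewrite ?inE//; first exact: measurableU.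
  move=> x _; have [phi0|phi0] := eqVneq (phi x) 0; first by right; exact: phiZ.
  left; apply: sA => /= /(_ I) /eqP; rewrite eqe.
  exact/negP.
rewrite -set_itvNyy lebesgue_measure_itv/=.
rewrite (null_set_setU mA mZ A0).
  by [].
exact: countable_lebesgue_measure0.
Qed.

(** If V <P, P> = 0 then <V P, V P> = V <P, P> V^* = 0, so V P = 0 by definiteness, and V = 0
    because P is monic. *)
Lemma wprod_unit (P : {poly 'M[C]_N.+1}) : P \is monic -> wprod W P P \in unitmx.
Proof.
move=> Pmonic; rewrite -row_free_unit -kermx_eq0; apply/eqP.
set V := kermx _; have V0 : V *m wprod W P P = 0 by exact: mulmx_ker.
have : V%:P * P = 0.
  apply: wprod_definite.
  rewrite wprodE// mul_polyC mformZl mformZr//; last exact: moment_adj.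
  by rewrite -wprodE// mulrA -[V * _]/(V *m _) V0 mul0r.
move=> /(congr1 lead_coef); rewrite lead_coef_Mmonic// lead_coefC lead_coef0.
by [].
Qed.

End Positivity.

(** * Ladder coefficients *)

Section SumReindexing.
Context {V : nmodType}.
Implicit Type f : nat -> V.

Lemma sum_ord_vanish a b f : (a <= b)%N -> (forall r, (a <= r)%N -> f r = 0) ->
  \sum_(r < b) f r = \sum_(r < a) f r.
Proof.
move=> ab f0; rewrite (big_ord_widen _ f ab) [RHS]big_mkcond.
by apply: eq_bigr => r _; case: ltnP => // /f0.
Qed.

Lemma sum_ord_shift a b f : (forall r, (r < a)%N -> f r = 0) ->
  \sum_(k < b) f (a + k)%N = \sum_(r < a + b) f r.
Proof.
by move=> f0; rewrite big_split_ord /= [X in _ = X + _]big1 ?add0r// => r _; exact: f0.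
Qed.

End SumReindexing.

Section FormOfDividedDifference.
Context {C : numClosedFieldType} {N : nat}.
Variable mu : nat -> 'M[C]_N.+1.
Implicit Types p q F : {poly 'M[C]_N.+1}.

Lemma mform_coef_r p q a : (size q <= a)%N ->
  mform mu p q = \sum_(s < a) mform mu p 'X^s * (q`_s)^t*.
Proof.
move=> hq; rewrite (mform_wide _ (leqnn _) hq) exchange_big; apply: eq_bigr => s _.
by rewrite mform_Xn_r mulr_suml.
Qed.

(** The moments of p below a drop out; the remaining sum is reversed to match the A_n and B_n sums,
    where j counts down from the top degree. *)
Lemma mform_divdiff_r p F w a b :
  (forall s, (s < a)%N -> mform mu p 'X^s = 0) -> (size F <= (a + b).+1)%N ->
  mform mu p (divdiff w F) =
  \sum_(j < b) mform mu p 'X^(a + (b - j.+1)) *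
    ((drop_poly (a + (b - j.+1)).+1 F).[w])^t*.
Proof.
move=> p0 hF; pose f s := mform mu p 'X^s * ((drop_poly s.+1 F).[w])^t*.
transitivity (\sum_(s < a + b) f s).
  rewrite (@mform_coef_r _ _ (a + b)) /f; last first.
    apply/leq_sizeP => s hs.
    by rewrite coef_divdiff horner_drop_poly_oversize// (leq_trans hF).
  by apply: eq_bigr => s _; rewrite coef_divdiff.
rewrite -sum_ord_shift; last by move=> s hs; rewrite /f p0// mul0r.
by rewrite (reindex_inj rev_ord_inj).
Qed.

End FormOfDividedDifference.

Section Coefficients.
Context {R : realType} {N : nat}.
Local Notation C := R[i].
Variable P : nat -> {poly 'M[C]_N.+1}.
Hypothesis size_P : forall n, size (P n) = n.+1.
Implicit Types (n : nat) (z : C) (K : {poly 'M[C]_N.+1}).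

Lemma coef_a_sub n i :
  coef_a P n (n%:Z - i%:Z) = if (i <= n)%N then (P n)`_(n - i) else 0.
Proof.
case: leqP => h; first by rewrite subzn.
by have -> : n%:Z - i%:Z = Negz (i - n.+1) by lia.
Qed.

Lemma Ptrunc_poly n k z :
  Ptrunc P n k z = (\poly_(s < k.+1) coef_a P n (n%:Z - (k - s)%:Z)).[z%:M].
Proof.
rewrite horner_poly (reindex_inj rev_ord_inj) /=; apply: eq_bigr => s _.
rewrite !subSS -rmorphXn /= -[_ * _]/(_ *m _) mul_mx_scalar.
by have -> : (k - (k - s))%N = s by have := ltn_ord s; lia.
Qed.

(** Delta_{j,n} consists of the coefficients of P_n K in degrees n + m - j and above, shifted down.
    These degrees involve only K_r with r >= m - j, since P_n has degree n. *)
Lemma Delta_drop_poly K n j z : (j <= mdeg K)%N ->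
  Delta P K j n z = mxeval (drop_poly (n + (mdeg K - j)) (P n * K)) z.
Proof.
move=> hj; set m := mdeg K.
pose D := \sum_(k < j.+1)
  (\poly_(s < k.+1) coef_a P n (n%:Z - (k - s)%:Z)) * (K`_(m - j + k))%:P.
have -> : Delta P K j n z = mxeval D z.
  rewrite /mxeval horner_sum; apply: eq_bigr => k _.
  rewrite hornerM_comm ?hornerC -?Ptrunc_poly//.
  by rewrite /comm_poly hornerC; apply/esym/scalar_mxC.
congr mxeval; apply/polyP => s; rewrite coef_drop_poly coefMr coef_sum.
set t := (s + _)%N.
pose f r := (if (r <= t)%N then (P n)`_(t - r) else 0) * K`_r.
rewrite [RHS](_ : _ = \sum_(r < t.+1) f r); last first.
  by apply: eq_bigr => r _; rewrite /f -ltnS ltn_ord.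
have f_gt r : (m < r)%N -> f r = 0.
  by move=> hr; rewrite /f [K`_r]nth_default ?mulr0//; apply: leq_trans (leqSpred _) hr.
have f_gt' r : (t < r)%N -> f r = 0 by rewrite /f ltnNge => /negPf ->; rewrite mul0r.
have f_lt r : (r < m - j)%N -> f r = 0.
  move=> hr; rewrite /f; case: ifP => _; rewrite ?mul0r// nth_default ?mul0r// size_P.
  by rewrite /t; lia.
(* Both sums are compared through a common longer range, then cut to m - j <= r <= m. *)
rewrite -(@sum_ord_vanish _ _ (m.+1 + t.+1) f) ?leq_addl//.
rewrite (@sum_ord_vanish _ m.+1 _ f) ?leq_addr//.
rewrite (_ : m.+1 = (m - j + j.+1)%N); last lia.
rewrite -sum_ord_shift//; apply: eq_bigr => k _.
rewrite coefMC coef_poly /f; congr (_ * _); have hk := ltn_ord k.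
case: ltnP => hsk.
  rewrite coef_a_sub /t; case: ifPn => h1; case: ifPn => h2 //; try lia.
  by congr (_`_ _); lia.
case: ifP => // h; rewrite nth_default// size_P /t; lia.
Qed.

End Coefficients.

(** * The coefficients A_n and B_n as forms of divided differences *)

Section LadderCoefficients.
Context {R : realType} {N : nat}.
Local Notation C := R[i].
Variables (W : R -> 'M[R]_N.+1) (P : nat -> {poly 'M[C]_N.+1}).
Hypothesis hW : is_weight W.
Hypothesis hP : monic_orthogonal W P.
Let mu := moment W.
Implicit Types (n : nat) (z : C) (K : {poly 'M[C]_N.+1}).

Let P_monic n : P n \is monic. Proof. by have [] := hP n. Qed.

Let size_P n : size (P n) = n.+1. Proof. by have [] := hP n. Qed.

Let P_orth n (q : {poly 'M[C]_N.+1}) : (size q <= n)%N -> mform mu (P n) q = 0.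
Proof. by move=> hq; rewrite -wprodE//; have [_ _] := hP n; apply. Qed.

Let norm_gamma n : mform mu (P n) (P n) * gamma W P n = 1.
Proof. by rewrite -wprodE//; apply: mulmxV; exact: wprod_unit. Qed.

Let gamma_norm n : gamma W P n * mform mu (P n) (P n) = 1.
Proof. by rewrite -wprodE//; apply: mulVmx; exact: wprod_unit. Qed.

Let gamma_adj n : (gamma W P n)^t* = gamma W P n.
Proof. exact: (inv_norm_adj (moment_adj hW) norm_gamma). Qed.

Let orthXn n s : (s < n)%N -> mform mu (P n) 'X^s = 0.
Proof. by move=> sn; rewrite P_orth// size_polyXn. Qed.

Let coef_b_mform n (k : nat) : coef_b W P n k%:Z = mform mu (P n) 'X^k.
Proof. by rewrite coef_bE ?wprodE//; have [_ _] := hP n. Qed.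

Let size_PK n K : (size (P n * K)%R <= (n + mdeg K).+1)%N.
Proof.
have [->|K0] := eqVneq K 0; first by rewrite mulr0 size_poly0.
apply: (leq_trans (size_polyMleq _ _)).
by rewrite size_P /mdeg -addnS prednK ?size_poly_gt0.
Qed.

(** The number n + m - j - 1 is both the index of the moment of P_n and the degree of the
    coefficient of the divided difference. Only degrees n to n + m - 1 contribute. *)
Lemma sum_coef_b_Delta n K w :
  \sum_(j < mdeg K) coef_b W P n ((n + mdeg K)%:Z - j%:Z - 1) *m (Delta P K j n w)^t* =
  mform mu (P n) (divdiff w%:M (P n * K)).
Proof.
rewrite (mform_divdiff_r _ (@orthXn n) (size_PK n K)); apply: eq_bigr => j _.
have hj := ltn_ord j.
have -> : (n + mdeg K)%:Z - j%:Z - 1 = (n + (mdeg K - j.+1))%N%:Z by lia.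
rewrite [coef_b _ _ _ _]coef_b_mform (Delta_drop_poly size_P) 1?ltnW//.
by rewrite -addnS subnSK.
Qed.

(** The adjoint exchanges the two sums of A_n and moves the Hermitian gamma_n to the right. *)
Lemma star_calA n K z :
  star (calA W P n K) z =
  - ((mform mu (divdiff z%:M (P n * K)) (P n) +
      mform mu (P n) (divdiff (z^*)%:M (P n * K))) * gamma W P n).
Proof.
have mu_adj := moment_adj hW.
rewrite /star /calA big_split /= /star conjCK sum_coef_b_Delta.
rewrite ctrmxN [(_ *m _)^t*]ctrmxM gamma_adj ctrmxD (mform_adj mu_adj).
congr (- ((_ + _) * _)); rewrite ctrmx_sum -sum_coef_b_Delta.
by apply: eq_bigr => j _; rewrite [LHS]ctrmxM trmxCK.
Qed.

Lemma calB_succ n K z :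
  calB W P n.+1 K z =
  - ((mform mu (divdiff z%:M (P n.+1 * K)) (P n) +
      mform mu (P n.+1) (divdiff (z^*)%:M (P n * K))) * gamma W P n).
Proof.
have mu_adj := moment_adj hW.
rewrite /calB big_split /=; congr (- ((_ + _) * _)).
- rewrite -(mform_adj mu_adj).
  (* P_{n+1} K may have degree n + m + 1, so m + 1 moments of P_n enter. *)
  rewrite (mform_divdiff_r (b := (mdeg K).+1) _ (@orthXn n)); last first.
    by rewrite addnS -addSn size_PK.
  rewrite ctrmx_sum; apply: eq_bigr => j _.
  have hj := ltn_ord j.
  have -> : (n.+1 + mdeg K)%:Z - j%:Z - 1 = (n + ((mdeg K).+1 - j.+1))%N%:Z by lia.
  rewrite [coef_b _ _ _ _]coef_b_mform (Delta_drop_poly size_P) -1?ltnS//.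
  rewrite ctrmxM trmxCK.
  by rewrite addSn subSS.
(* The term j = m carries b_{n+1,n-1} = 0; for n = 0 its second index is negative. *)
- rewrite big_ord_recr /= [X in _ + X](_ : _ = 0) ?addr0; last first.
    rewrite (_ : coef_b _ _ _ _ = 0) ?mul0mx//.
    have -> : (n.+1 + mdeg K)%:Z - (mdeg K)%:Z - 2 = n%:Z - 1 by lia.
    case: (n) => [|k] //; have -> : k.+1%:Z - 1 = k%:Z by lia.
    by rewrite /= ltnNge leqnSn.
  (* Starting at n instead of n + 1 keeps the zero moment <P_{n+1}, X^n>, as the sum in B_{n+1}
     does. *)
  rewrite (@mform_divdiff_r _ _ mu _ _ _ n (mdeg K)) ?size_PK//; last first.
    by move=> s /leqW; exact: orthXn.
  apply: eq_bigr => j _; have hj := ltn_ord j.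
  have -> : (n.+1 + mdeg K)%:Z - j%:Z - 2 = (n + (mdeg K - j.+1))%N%:Z by lia.
  rewrite [coef_b _ _ _ _]coef_b_mform /star (Delta_drop_poly size_P) 1?ltnW//.
  by rewrite -addnS subnSK.
Qed.

Variable G : {poly 'M[C]_N.+1}.
Hypothesis pearson : forall k, mu k.-1 *+ k +
  \sum_(r < size G) (G`_r * mu (r + k) + mu (r + k) * (G`_r)^t*) = 0.

Lemma P0E : P 0%N = 1.
Proof.
have /size1_polyC e : (size (P 0) <= 1)%N by rewrite size_P.
by have /monicP := P_monic 0; rewrite e lead_coefC => ->.
Qed.

Lemma mxevalM p q z : mxeval (p * q) z = mxeval p z *m mxeval q z :> 'M[C]_N.+1.
Proof.
by rewrite /mxeval hornerM_comm// /comm_poly; apply/esym/scalar_mxC.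
Qed.

Lemma lowering_relation n z :
  mxeval (P n)^`() z + mxeval (P n) z *m mxeval G z =
  - calB W P n G z *m mxeval (P n) z
  + star (calA W P n G) z *m beta W P n *m mxeval (Pprev P n) z.
Proof.
(* For n = 0 both sides equal G(z), by the convention B_0 = -G. *)
case: n => [|n].
  by rewrite P0E /= -polyC1 derivC /mxeval horner0 hornerC add0r mul1mx opprK
    mulmx1 mulmx0 addr0.
have mu_adj := moment_adj hW.
rewrite -mxevalM star_calA calB_succ /= opprK.
rewrite [LHS](lowering_form mu_adj P_monic size_P P_orth norm_gamma gamma_norm _
  (mform_skew mu_adj pearson)).
congr (_ + _).
(* The factor gamma_{n+1} ending A_{n+1}^* meets beta_{n+1} = h_{n+1} gamma_n, leaving the gamma_n
   of [lowering_form]. *)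
have gammaK (Z : 'M[C]_N.+1) :
    gamma W P n.+1 *m (wprod W (P n.+1) (P n.+1) *m Z) = Z.
  exact/mulKmx/wprod_unit.
by rewrite /beta invmxK !mulNmx -!mulmxA gammaK !mulmxA.
Qed.

Lemma three_term_eval n z :
  (z%:M - alpha P n) *m mxeval (P n) z =
  mxeval (P n.+1) z + beta W P n *m mxeval (Pprev P n) z.
Proof.
have alphaE : alpha P n = rec_diag P n.
  rewrite /alpha /rec_diag coefMX; case: n => [|n] //.
  by have -> : n.+1%:Z - 1 = n%:Z by lia.
have prevE : mxeval (rec_prev mu P (gamma W P) n) z =
    beta W P n *m mxeval (Pprev P n) z.
  case: n {alphaE} => [|n] /=; first by rewrite /mxeval horner0 mulmx0.
  by rewrite /mxeval hornerZ invmxK wprodE.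
have := three_term (moment_adj hW) P_monic size_P P_orth norm_gamma gamma_norm n.
move=> /(congr1 (fun p => mxeval p z)); rewrite /mxeval hornerMX !hornerD hornerZ.
rewrite -[(rec_prev _ _ _ _).[_]]/(mxeval _ _) prevE -alphaE => e.
rewrite mulmxBl -scalar_mxC [(P n).[_] *m _]e [alpha P n * _]/(alpha P n *m _).
by rewrite addrAC addrK.
Qed.

End LadderCoefficients.

Theorem proposition3p6 (R : realType) (N : nat)
  (W : R -> 'M[R]_N.+1) (T : R -> 'M[R[i]]_N.+1)
  (G : {poly 'M[R[i]]_N.+1}) (P : nat -> {poly 'M[R[i]]_N.+1})
  (hW : is_weight W)
  (hT : csmooth T)
  (hWT : forall x : R, cmx (W x) = T x *m (T x) ^t*)
  (hTG : forall x : R, cderive1 T x = mxeval G (x%:C)%C *m T x)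
  (hP : monic_orthogonal W P) :
  forall (n : nat) (z : R[i]),
    (mxeval (P n)^`() z + mxeval (P n) z *m mxeval G z =
       - calB W P n G z *m mxeval (P n) z
       + star (calA W P n G) z *m beta W P n *m mxeval (Pprev P n) z)
    /\
    (mxeval (P n)^`() z + mxeval (P n) z *m mxeval G z =
       (star (calA W P n G) z *m (z%:M - alpha P n) - calB W P n G z)
         *m mxeval (P n) z
       - star (calA W P n G) z *m mxeval (P n.+1) z).
Proof.
move=> n z.
have lowering := lowering_relation hW hP (moment_pearson hW hT hWT hTG) n z.
split; first exact: lowering.
(* Substituting (z - alpha_n) P_n = P_{n+1} + beta_n P_{n-1} makes the P_{n+1} terms cancel. *)
rewrite lowering mulmxBl -[_ *m (z%:M - _) *m _]mulmxA (three_term_eval hW hP) mulmxDr mulmxA.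
by rewrite mulNmx addrC [RHS]addrAC [X in _ = X - _]addrAC subrr add0r.
Qed.
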